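(* Let $\mathbb{K}$ be an algebraically closed field of characteristic zero, $V$ a finite-dimensional $\mathbb{K}$-vector space, $X\subseteq V$ an irreducible Zariski-closed affine cone whose $\mathbb{K}$-linear span is $V$, and $h\in V^*\setminus\{0\}$. Put $H=\{v\in V\mid h(v)=1\}$ and $X_1=X\cap H$. Then the function $k\mapsto \dim \sigma_kX_1$ (on positive integers $k$) is strictly increasing until it coincides with its maximal value $\dim H=\dim V-1$, and it is constant from then on. Let $k_0$ be the minimal integer $k$ for which $\sigma_kX_1=kH$ holds. Then for every $v\in V\setminus\ker(h)$ we have $$\operatorname{rk}_X(v)\le \operatorname{mrk}_{X,h}(v)\le 2k_0.$$ In particular, the monic rank is finite.
   Context: For a positive integer $k$, $kH:=\{kp\mid p\in H\}=\{v\in V\mid h(v)=k\}$. The $k$-th open secant variety of $X_1$ is $\overset{\circ}{\sigma}_kX_1:=\{p_1+\cdots+p_k\mid p_1,\dots,p_k\in X_1\}\subseteq kH$, and $\sigma_kX_1$ is its Zariski closure. The $X$-rank $\operatorname{rk}_X(v)$ of $v\in V$ is the minimal number of points of $X$ whose sum is $v$. The monic rank of $v\in V\setminus\ker(h)$ is $$\operatorname{mrk}_{X,h}(v):=\inf\left\{k\in\mathbb{Z}_{\ge1}\;\middle|\;\tfrac{k}{h(v)}\cdot v\in\overset{\circ}{\sigma}_kX_1\right\}.$$ *)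

(* Defs.v *)
From HB Require Import structures.
From mathcomp Require Import all_boot all_algebra.
From mathcomp Require Import classical_sets.
From mathcomp Require Import mpoly.

Set Implicit Arguments.
Unset Strict Implicit.
Unset Printing Implicit Defensive.

Import GRing.Theory.
Local Open Scope ring_scope.
Local Open Scope classical_set_scope.

Section Zariski.
Variables (K : closedFieldType) (V : vectType K).

(* Polynomial functions on V are read in the coordinates of the basis
   vbasis {:V}; the class of polynomial functions does not depend on it. *)
Definition peval (p : {mpoly K[\dim {:V}]}) (v : V) : K :=
  p.@[fun i => coord (vbasis {:V}) i v].

Definition zero_locus (S : set {mpoly K[\dim {:V}]}) : set V :=
  [set v | forall p, S p -> peval p v = 0].

Definition zclosed (Z : set V) : Prop := exists S, Z = zero_locus S.

Definition zclosure (A : set V) : set V := smallest zclosed A.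

Definition zirreducible (Z : set V) : Prop :=
  Z !=set0 /\
  forall A B, zclosed A -> zclosed B ->
    Z `<=` A `|` B -> Z `<=` A \/ Z `<=` B.

(* C 0, ..., C d is a strictly increasing chain of irreducible closed subsets
   of Z; the values of C beyond d are irrelevant. *)
Definition zchain (Z : set V) (d : nat) (C : nat -> set V) : Prop :=
  (forall i, (i <= d)%N -> [/\ zclosed (C i), zirreducible (C i) & C i `<=` Z])
  /\ (forall i, (i < d)%N -> C i `<` C i.+1).

(* Krull dimension. Meant for closed Z: the members of a chain are closed in V,
   which agrees with closed in Z only then. *)
Definition has_zdim (Z : set V) (d : nat) : Prop :=
  (exists C, zchain Z d C) /\
  (forall e C, zchain Z e C -> (e <= d)%N).

Definition affine_cone (X : set V) : Prop :=
  forall (a : K) (x : V), X x -> X (a *: x).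

Definition spans (X : set V) : Prop :=
  forall U : {vspace V}, (forall x, X x -> x \in U) -> U = fullv.

Definition open_secant (k : nat) (A : set V) : set V :=
  [set v | exists2 p : 'I_k -> V, (forall i, A (p i)) & v = \sum_i p i].

Definition secant (k : nat) (A : set V) : set V := zclosure (open_secant k A).

Definition dilate (k : nat) (A : set V) : set V := [set p *+ k | p in A].

Definition hyperplane1 (h : 'Hom(V, K^o)) : set V := [set v | h v = 1].

Definition is_least (S : set nat) (k : nat) : Prop :=
  S k /\ forall j, S j -> (k <= j)%N.

(* Ranks are relations rather than functions: the infimum of a set of natural
   numbers is finite iff the set has a least element, which is then its value,
   so has_mrank X h v m also says that the monic rank of v is finite. *)
Definition has_rank (X : set V) (v : V) (r : nat) : Prop :=
  is_least [set k | open_secant k X v] r.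

Definition has_mrank (X : set V) (h : 'Hom(V, K^o)) (v : V) (m : nat) : Prop :=
  is_least [set k | (0 < k)%N /\
    open_secant k (X `&` hyperplane1 h) ((k%:R / (h v : K)) *: v)] m.

End Zariski.

(* Main.v *)
(* Write S_k for the closure of the open secant variety. For p in X_1 the
   translate p + S_k is a closed subset of the irreducible S_{k+1}. If it is a
   proper subset for some p, the dimension grows. If it is everything for all p,
   then S_k is stable under X_1 - X_1; being closed in characteristic zero it is
   stable under the linear span of these differences, which is ker h, so that
   S_k = kH.

   If S_k = kH, the open secant variety contains a nonempty open subset U of kH,
   by elimination of the coordinates of the k points one at a time. For w in
   2kH, the open sets U and w - U of the irreducible kH meet, so w lies in U + U.

   The only dimension theory required is that chains in an n-dimensional space
   have length at most n: each step of a chain adds a function that vanishes on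
   the smaller set to an algebraically independent family, and n + 1 polynomials
   in n variables are algebraically dependent. *)
Require Import Defs.
From HB Require Import structures.
From mathcomp Require Import all_boot all_algebra.
From mathcomp Require Import boolp classical_sets.
From mathcomp Require Import mpoly zify ring.

Set Implicit Arguments.
Unset Strict Implicit.
Unset Printing Implicit Defensive.

Import GRing.Theory.
Local Open Scope ring_scope.
Local Open Scope classical_set_scope.

(** * Elimination of one variable *)

Lemma ex_least (S : set nat) n : S n -> exists m, is_least S m.
Proof.
move=> Sn; have ex : exists n, `[< S n >] by exists n; apply/asboolP.
case: (ex_minnP ex) => m /asboolP Sm min; exists m; split=> // j Sj.
exact/min/asboolP.
Qed.

Lemma ex_least_measure (T : Type) (f : T -> nat) (P : T -> Prop) x0 :
  P x0 -> exists2 x, P x & forall y, P y -> (f x <= f y)%N.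
Proof.
move=> Px0; have [|m [[x Px <-] min]] := @ex_least [set f x | x in P] (f x0).
  by exists x0.
by exists x => // y Py; apply: min; exists y.
Qed.

Section Ideals.
Variables (A : idomainType).
Implicit Types (M I : set {poly A}) (p q : {poly A}).

Definition is_ideal M :=
  [/\ M 0, forall p q, M p -> M q -> M (p + q) & forall p q, M q -> M (p * q)].

Definition is_prime_ideal M :=
  is_ideal M /\ forall p q, M (p * q) -> M p \/ M q.

(** For an ideal [I], these are the polynomials that become zero modulo the contraction [J] of [I]
    to [A]. *)
Definition coefs_in I p := forall i, I (p`_i)%:P.

Lemma ideal_sum M n (F : 'I_n -> {poly A}) :
  is_ideal M -> (forall i, M (F i)) -> M (\sum_i F i).
Proof. by move=> [M0 MD _] MF; elim/big_ind: _. Qed.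

Lemma coefs_in_sub I p : is_ideal I -> coefs_in I p -> I p.
Proof.
move=> [I0 ID IM] Jp; rewrite -[p]coefK poly_def.
elim/big_ind: _ => // i _; rewrite -mul_polyC mulrC; exact: IM.
Qed.

Lemma ideal_sub M p q : is_ideal M -> M p -> M q -> M (p - q).
Proof.
by move=> [_ MD MM] Mp Mq; apply: MD => //; rewrite -mulN1r; apply: MM.
Qed.

Lemma ideal_modp M p q : is_ideal M -> M p -> M q -> M (p %% q).
Proof.
move=> MI Mp Mq; have [_ _ MM] := MI.
rewrite -[_ %% _](addKr (p %/ q * q)) -Pdiv.Idomain.divp_eq addrC.
by apply: ideal_sub; rewrite // -?mul_polyC; apply: MM.
Qed.

(** If the leading coefficient of a smallest such element lay in [I], its leading term would lie in
    [I], hence in [M], and removing it would leave a smaller such element. Pseudo-division by [q]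
    thus stays meaningful modulo the contraction of [I]. *)
Lemma min_size_lead I M p : is_ideal I -> is_ideal M -> I `<=` M ->
  M p -> ~ coefs_in I p ->
  exists q, [/\ M q, ~ I (lead_coef q)%:P &
                forall r, M r -> (size r < size q)%N -> coefs_in I r].
Proof.
move=> II MI IM Mp Jp.
have [q [Mq Jq] min] := @ex_least_measure _ (fun q : {poly A} => size q)
  (fun q => M q /\ ~ coefs_in I q) p (conj Mp Jp).
have small r : M r -> (size r < size q)%N -> coefs_in I r.
  by move=> Mr; apply: contraPP => Jr; apply/negP; rewrite -leqNgt min.
exists q; split=> // Il.
have [I0 ID IMu] := II.
set l := lead_coef q *: 'X^((size q).-1).
have Il' : I l by rewrite /l -mul_polyC mulrC; apply: IMu.
have q_n0 : q != 0.
  by apply/eqP => q0; apply: Jq => i; rewrite q0 coef0.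
apply: Jq.
have Jr : coefs_in I (q - l).
  apply: small; first by apply: ideal_sub => //; apply: IM.
  rewrite -[X in (_ < X)%N]prednK ?size_poly_gt0 // ltnS.
  apply/leq_sizeP => j; rewrite leq_eqVlt => /orP[/eqP <-|ltj].
    by rewrite coefB coefZ coefXn eqxx mulr1 subrr.
  rewrite coefB coefZ coefXn gtn_eqF // mulr0 subr0 nth_default //.
  by move: ltj; case: (size q).
move=> i; rewrite -[q](subrK l) coefD polyCD; apply: ID => //.
rewrite coefZ coefXn; case: eqP => _; rewrite ?mulr1 // mulr0; exact: I0.
Qed.

(** Removes the powers of leading coefficients that pseudo-division introduces. *)
Lemma prime_exp I a n p : is_prime_ideal I -> ~ I a%:P ->
  I (a ^+ n *: p) -> I p.
Proof.
move=> [_ Ip] Ia; elim: n => [|n IHn]; first by rewrite expr0 scale1r.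
by rewrite exprS -scalerA -mul_polyC => /Ip[].
Qed.

(* If T is algebraic modulo J, the set of constants in I, then F is its minimal
   polynomial and G a gcd of F and b, hence a constant modulo J since I is
   prime; off lead F * lead G = 0 any root of F extends phi, and b is nonzero
   there because G is. If T is transcendental, I is generated by J. *)
Lemma elimination_step (K : closedFieldType) I b :
    is_prime_ideal I -> ~ I b ->
  exists2 a, ~ I a%:P & forall phi : {rmorphism A -> K},
    (forall c, I c%:P -> phi c = 0) -> phi a != 0 ->
    exists t, (forall p, I p -> (map_poly phi p).[t] = 0) /\
              (map_poly phi b).[t] != 0.
Proof.
move=> Iprime Ib; have [II Ip] := Iprime; have [I0 ID IM] := II.
have JI := coefs_in_sub II.
have mapJ (phi : {rmorphism A -> K}) p : (forall c, I c%:P -> phi c = 0) ->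
    coefs_in I p -> map_poly phi p = 0.
  by move=> phiJ Jp; apply/polyP => i; rewrite coef_map coef0 /= phiJ.
have [sIJ|/existsNP[F0 /not_implyP[IF0 JF0]]] := pselect (forall p, I p -> coefs_in I p).
  have /existsNP[i Ibi] : ~ coefs_in I b by move/JI.
  exists b`_i => // phi phiJ phib.
  have /closed_nonrootP[t nt] : map_poly phi b != 0.
    by apply: contraNneq phib => e; rewrite -coef_map e coef0.
  by exists t; split=> [p Ip'|//]; rewrite mapJ ?horner0 //; apply: sIJ.
have [F [IF IlF minF]] := min_size_lead II II (@subset_refl _ I) IF0 JF0.
(* The ideal generated by [I] and [b]. The cofactor [w] of [b] serves at the end to transfer
   nonvanishing from [G] to [b]. *)
pose M := [set p | exists w, I (p - w * b)].
have MI : is_ideal M.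
  split=> [|p q [w Iw] [w' Iw']|p q [w Iw]]; first by exists 0; rewrite mul0r subr0.
  - by exists (w + w'); rewrite mulrDl opprD addrACA; apply: ID.
  - by exists (p * w); rewrite -mulrA -mulrBr; apply: IM.
have sIM : I `<=` M by move=> p Ip'; exists 0; rewrite mul0r subr0.
have Mb : M b by exists 1; rewrite mul1r subrr.
have [G [MG IlG minG]] := min_size_lead II MI sIM Mb (fun J => Ib (JI _ J)).
have n0 p : ~ I (lead_coef p)%:P -> p != 0.
  by move=> Ilp; apply/eqP => p0; apply: Ilp; rewrite p0 lead_coef0.
have F0' := n0 _ IlF; have G0' := n0 _ IlG.
have dvG p : M p -> I (lead_coef G ^+ scalp p G *: p - p %/ G * G).
  move=> Mp; rewrite Pdiv.Idomain.divp_eq addrC addKr.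
  apply: JI; apply: minG; last by rewrite Pdiv.Idomain.ltn_modp.
  exact: ideal_modp.
have leGF : (size G <= size F)%N.
  rewrite leqNgt; apply/negP => lt; apply: IlF; rewrite lead_coefE.
  by apply: minG => //; apply: sIM.
(* If [G] had positive degree, primality applied to [F %/ G * G] would either put [G], hence [b], in
   [I], or put the smaller [F %/ G] in [I], and then the leading coefficient of [F] as well. *)
have sizeG : size G = 1%N.
  apply/eqP; case: ltngtP => // [|gt1].
    by rewrite ltnS leqn0 size_poly_eq0 (negPf G0').
  have IdF := dvG _ (sIM _ IF).
  have : I (F %/ G * G).
    rewrite -[_ * G](subKr (lead_coef G ^+ scalp F G *: F)).
    by apply: ideal_sub; rewrite // -mul_polyC; apply: IM.
  case/Ip => [IQ|IG]; last first.
    case: Ib; apply: prime_exp (scalp b G) _ Iprime IlG _.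
    by rewrite -[_ *: b](subrK (b %/ G * G)); apply: ID; [apply: dvG|apply: IM].
  have JQ : coefs_in I (F %/ G).
    apply: minF => //; rewrite Pdiv.Idomain.size_divp //.
    rewrite ltn_subrL size_poly_gt0 F0' andbT.
    by move: gt1; case: (size G).
  have JR : coefs_in I (F %% G).
    apply: minG; last by rewrite Pdiv.Idomain.ltn_modp.
    by apply: ideal_modp => //; apply: sIM.
  have : I (lead_coef (lead_coef G ^+ scalp F G *: F))%:P.
    rewrite lead_coefE Pdiv.Idomain.divp_eq coefD polyCD; apply: ID => //.
    rewrite coefM rmorph_sum /=; apply: ideal_sum => // i.
    by rewrite polyCM mulrC; apply: IM.
  rewrite lead_coefZ polyCM mul_polyC => /(prime_exp Iprime IlG)/IlF[].
have [w Iw] := MG.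
pose a := lead_coef G * lead_coef F; exists a; first by rewrite polyCM => /Ip[].
move=> phi phiJ; rewrite rmorphM mulf_eq0 negb_or => /andP[phiG phiF].
have /closed_rootP[t /rootP Ft0] : size (map_poly phi F) != 1%N.
  rewrite size_map_poly_id0 //; apply/eqP => sF1; apply: IlF.
  by move: IF; rewrite [F]size1_polyC ?sF1 // lead_coefC.
(* Pseudo-division by [F] leaves a remainder whose coefficients [phi] kills, while [phi] does not
   kill the leading coefficient of [F]. *)
have It0 p : I p -> (map_poly phi p).[t] = 0.
  move=> Ipp; have := congr1 (map_poly phi) (Pdiv.Idomain.divp_eq p F).
  rewrite map_polyZ rmorphD rmorphM /= (mapJ phi (p %% F)) //; last first.
    apply: minF; last by rewrite Pdiv.Idomain.ltn_modp.
    exact: ideal_modp.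
  rewrite addr0 => /(congr1 (fun q : {poly K} => q.[t])); rewrite hornerZ hornerM Ft0 mulr0.
  by move/eqP; rewrite rmorphXn mulf_eq0 expf_eq0 (negPf phiF) andbF => /eqP.
exists t; split=> //; apply: contraNneq phiG => bt0.
have := It0 _ Iw; rewrite rmorphB rmorphM hornerD hornerN hornerM bt0 mulr0 subr0.
by rewrite [G]size1_polyC ?sizeG // lead_coefC /= map_polyC hornerC => ->.
Qed.

End Ideals.

(** * Elimination of several variables *)

Lemma mpoly_ring_ind (n : nat) (R : nzRingType) (P : {mpoly R[n]} -> Prop) :
    (forall c, P c%:MP) -> (forall i, P 'X_i) ->
    (forall p q, P p -> P q -> P (p + q)) ->
    (forall p q, P p -> P q -> P (p * q)) ->
  forall p, P p.
Proof.
move=> PC PX PD PM; apply: mpolyind => [|c m p _ _ Pp]; first by rewrite -mpolyC0.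
apply: (PD) => //; rewrite -mul_mpolyC mpolyXE_id; apply: (PM) => //.
elim/big_ind: _ => [|x y|i _]; [by rewrite -mpolyC1|exact: PM|].
by elim: (m i) => [|k IHk]; rewrite ?expr0 -?mpolyC1 // exprS; apply: PM.
Qed.

Lemma mpoly0_const (R : nzRingType) (p : {mpoly R[0]}) : exists c, p = c%:MP.
Proof.
elim/mpoly_ring_ind: p => [c|[]|p q [c ->] [d ->]|p q [c ->] [d ->]] //.
- by exists c.
- by exists (c + d); rewrite mpolyCD.
- by exists (c * d); rewrite mpolyCM.
Qed.

(** Packaged as a morphism so that [{poly A}] can replace [A] as base ring in the induction on the
    number of variables. *)
Definition horner_hom (A K : comNzRingType) (phi : {rmorphism A -> K}) (t : K) :
    {rmorphism {poly A} -> K} :=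
  horner_morph (fun a => mulrC t (phi a)).

Lemma horner_homC (A K : comNzRingType) (phi : {rmorphism A -> K}) t a :
  horner_hom phi t a%:P = phi a.
Proof. exact: horner_morphC. Qed.

Lemma horner_homX (A K : comNzRingType) (phi : {rmorphism A -> K}) t :
  horner_hom phi t 'X = t.
Proof. exact: horner_morphX. Qed.

Definition first_var (n : nat) (T : Type) (t : T) (s : 'I_n -> T) (i : 'I_n.+1) :=
  if unlift ord0 i is Some j then s j else t.

Definition constC (n : nat) (A : idomainType) :
    {rmorphism A -> {mpoly {poly A}[n]}} := @mpolyC n {poly A} \o polyC.

(** The identification of [A[x_0, ..., x_n]] with [A[X][x_1, ..., x_n]]: one variable moves into the
    coefficient ring. *)
Definition split_first (n : nat) (A : idomainType) (p : {mpoly A[n.+1]}) :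
    {mpoly {poly A}[n]} :=
  mmap (constC n A) (first_var ('X : {poly A})%:MP (fun j => 'X_j)) p.

Lemma mmap_split_first (n : nat) (A : idomainType) (K : comNzRingType)
    (phi : {rmorphism A -> K}) t s p :
  mmap (horner_hom phi t) s (@split_first n A p) = mmap phi (first_var t s) p.
Proof.
elim/mpoly_ring_ind: p => [c|i|p q|p q].
- by rewrite /split_first !mmapC; apply: horner_homC.
- rewrite /split_first !mmapX !mmap1U /first_var.
  case: unlift => [j|]; first by rewrite mmapX mmap1U.
  by rewrite mmapC; apply: horner_homX.
- by rewrite /split_first !rmorphD /= => -> ->.
- by rewrite /split_first !rmorphM /= => -> ->.
Qed.

(* Points of an irreducible variety Y are presented by homs e y from A and
   finitely many further coordinates f i; the image of Y in Spec A contains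
   the nonempty open set a != 0. *)
Lemma elimination (K : closedFieldType) (T : Type) (Y : set T)
    (D : set (T -> K)) (n : nat) (A : idomainType)
    (e : T -> {rmorphism A -> K}) (f : 'I_n -> T -> K) :
    Y !=set0 ->
    (forall g g', D g -> D g' -> D (fun y => g y + g' y)) ->
    (forall g g', D g -> D g' -> D (fun y => g y * g' y)) ->
    (forall g g', D g -> D g' -> (forall y, Y y -> g y * g' y = 0) ->
       (forall y, Y y -> g y = 0) \/ (forall y, Y y -> g' y = 0)) ->
    (forall a, D (fun y => e y a)) -> (forall i, D (f i)) ->
  exists2 a, ~ (forall y, Y y -> e y a = 0) &
    forall phi : {rmorphism A -> K},
      (forall c, (forall y, Y y -> e y c = 0) -> phi c = 0) -> phi a != 0 ->
    exists t : 'I_n -> K, forall p : {mpoly A[n]},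
      (forall y, Y y -> mmap (e y) (f^~ y) p = 0) -> mmap phi t p = 0.
Proof.
move=> [y0 Yy0] DD DM Ddom; elim: n A e f => [|n IHn] A e f De Df.
  exists 1 => [/(_ _ Yy0)/eqP|phi phiJ _]; first by rewrite rmorph1 oner_eq0.
  exists (fun=> 0) => p; have [c ->] := mpoly0_const p.
  rewrite mmapC => Yc; apply: phiJ => y Yy; rewrite -(Yc y Yy).
  by rewrite mmapC.
(* The first coordinate is absorbed into the base ring. Irreducibility of [Y] is available for
   functions in [D] only, so the values of [{poly A}] have to be placed in [D]. *)
pose e' y : {rmorphism {poly A} -> K} := horner_hom (e y) (f ord0 y).
have De' p : D (fun y => e' y p).
  elim/poly_ind: p => [|p c Dp].
    have -> : (fun y => e' y 0) = (fun y => e y 0); last exact: De.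
    by apply/funext => y; rewrite !rmorph0.
  have -> : (fun y => e' y (p * 'X + c%:P)) =
            (fun y => e' y p * f ord0 y + e y c).
    by apply/funext => y; rewrite rmorphD rmorphM horner_homX horner_homC.
  by apply: (DD) => //; apply: DM.
have [b b0 IHb] := IHn _ e' (fun j => f (lift ord0 j)) De' (fun=> Df _).
pose I := [set p | forall y, Y y -> e' y p = 0].
have Iprime : is_prime_ideal I.
  split; first split=> [y _|p q Ip Iq y Yy|p q Iq y Yy].
  - exact: rmorph0.
  - by rewrite rmorphD Ip // Iq // addr0.
  - by rewrite rmorphM Iq // mulr0.
  move=> p q Ipq; apply: Ddom => // y Yy.
  by rewrite -rmorphM Ipq.
(* The induction hypothesis gave the open condition [b != 0] over [{poly A}]; eliminating [X] turns
   it into [a != 0] over [A]. *)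
have [a Ia aP] := elimination_step K Iprime b0.
exists a => [a0|phi phiJ phia].
  by apply: Ia => y Yy; rewrite horner_homC a0.
have [|//|t [tI tb]] := aP phi.
  by move=> c Ic; apply: phiJ => y Yy; rewrite -(Ic y Yy) horner_homC.
have [//|//|s sP] := IHb (horner_hom phi t).
exists (first_var t s) => p Ip; rewrite -mmap_split_first; apply: sP => y Yy.
rewrite mmap_split_first -[RHS](Ip y Yy).
congr mmap; apply/funext => i; rewrite /first_var.
by case: unliftP => [j|] ->.
Qed.

(** * Algebraic dependence of n + 1 polynomials in n variables *)

Section AlgebraicDependence.
Variables (K : fieldType) (n : nat).

(** [msize] is the degree plus one, and 0 at the zero polynomial; bounds of the form [a.+1] make
    degrees additive in all cases. *)
Lemma msizeM_leD (p q : {mpoly K[n]}) a b :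
  (msize p <= a.+1)%N -> (msize q <= b.+1)%N -> (msize (p * q) <= (a + b).+1)%N.
Proof.
move=> pa qb; have [->|p0] := eqVneq p 0; first by rewrite mul0r msize0.
have [->|q0] := eqVneq q 0; first by rewrite mulr0 msize0.
rewrite msizeM // -subn1 leq_subLR; apply: leq_trans (leq_add pa qb) _; lia.
Qed.

Lemma msizeX_leM (p : {mpoly K[n]}) d k :
  (msize p <= d.+1)%N -> (msize (p ^+ k) <= (k * d).+1)%N.
Proof.
move=> pd; elim: k => [|k IHk]; first by rewrite expr0 msize1.
by rewrite exprS mulSn msizeM_leD.
Qed.

(** Each exponent of a monomial of degree below [b] is itself below [b]. *)
Lemma card_bmultinom b : (#|{: 'X_{1..n < b}}| <= b ^ n)%N.
Proof.
case: b => [|b].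
  by rewrite (eq_card0 (A := {: 'X_{1..n < 0}})) // => m; have := bmdeg m.
have <- : #|{ffun 'I_n -> 'I_b.+1}| = (b.+1 ^ n)%N by rewrite card_ffun !card_ord.
pose F (m : 'X_{1..n < b.+1}) := [ffun i => inord (m i) : 'I_b.+1].
apply: (@leq_card _ _ F) => m m' /ffunP eqF; apply/val_inj/mnmP => i.
have le (m0 : 'X_{1..n < b.+1}) : (m0 i < b.+1)%N.
  by apply: leq_ltn_trans (bmdeg m0); rewrite mdegE (bigD1 i) //= leq_addr.
by have := eqF i; rewrite !ffunE => /(congr1 val); rewrite /= !inordK.
Qed.

(* Counting: the (D+1)^(n+1) products of the f i with exponents at most D lie
   in a space of polynomials whose dimension grows only like D^n. *)
Lemma algebraic_dependence (f : 'I_n.+1 -> {mpoly K[n]}) :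
  exists2 P : {mpoly K[n.+1]}, P != 0 & mmap (@mpolyC n K) f P = 0.
Proof.
pose d := (\max_i msize (f i))%N; pose c := (n.+1 * d).+1.
(* This choice gives [M <= D.+1 * c], so [M ^ n] is at most [D.+1 ^ n * D], which is below
   [D.+1 ^ n.+1]. *)
pose D := (c ^ n)%N; pose M := (n.+1 * (D * d)).+1.
pose I := {ffun 'I_n.+1 -> 'I_D.+1}; pose J : finType := 'X_{1..n < M}.
pose mon (a : I) : 'X_{1..n.+1} := [multinom (a i : nat) | i < n.+1].
pose F (a : I) := mmap1 f (mon a).
have sizeF a : (msize (F a) <= M)%N.
  have : (msize (F a) <= (\sum_(i < n.+1) D * d).+1)%N.
    rewrite /F /mmap1; elim/big_ind2: _ => [|p k q l|i _].
    - by rewrite msize1.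
    - exact: msizeM_leD.
    - rewrite mnmE; apply: leq_trans (msizeX_leM (d := d) _ _) _.
        by apply: leqW; apply: (leq_bigmax_cond (F := fun i => msize (f i))).
      by rewrite ltnS leq_mul2r -ltnS ltn_ord orbT.
  by rewrite sum_nat_const card_ord.
have card_lt : (#|{: J}| < #|{: I}|)%N.
  apply: leq_ltn_trans (card_bmultinom _) _.
  rewrite card_ffun !card_ord.
  have leM : (M <= D.+1 * c)%N by rewrite /M /c; nia.
  apply: (@leq_ltn_trans ((D.+1 * c) ^ n)); first by case: (n) => // n'; rewrite leq_exp2r.
  by rewrite expnMn expnSr ltn_pmul2l ?expn_gt0 // ltnS.
(* The rows hold the coefficients of the products [F a]. There are more rows than columns, so some
   nonzero row vector [u] kills [B] and gives the coefficients of the relation. *)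
pose B : 'M[K]_(#|{: I}|, #|{: J}|) :=
  \matrix_(a, b) (F (enum_val a))@_(bmnm (@enum_val J _ b)).
have : kermx B != 0.
  rewrite -mxrank_eq0 mxrank_ker -lt0n subn_gt0.
  exact: leq_ltn_trans (rank_leq_col B) card_lt.
case/rowV0Pn => u /sub_kermxP uB u0.
exists (\sum_(a : I) u 0 (enum_rank a) *: 'X_[mon a]).
  have [j uj] : exists j, u 0 j != 0.
    apply/existsP; apply: contraT; rewrite negb_exists => /forallP u00.
    by case/eqP: u0; apply/rowP => j; rewrite mxE; apply/eqP; rewrite -[_ == _]negbK.
  apply: contraNneq uj => /(congr1 (mcoeff (mon (enum_val j)))).
  rewrite mcoeff0 raddf_sum /= (bigD1 (enum_val j)) //= mcoeffZ mcoeffX eqxx.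
  rewrite mulr1 enum_valK big1 => [|a aj]; first by rewrite addr0 => ->.
  rewrite mcoeffZ mcoeffX.
  case: eqP => [/mnmP e|_]; last by rewrite mulr0.
  case/eqP: aj; apply/ffunP => i; apply/val_inj.
  by have := e i; rewrite !mnmE.
rewrite raddf_sum /=; apply/mpolyP => m; rewrite mcoeff0 raddf_sum /=.
have [ltm|gem] := ltnP (mdeg m) M; last first.
  rewrite big1 // => a _; rewrite mmapZ mmapX mcoeffCM.
  rewrite [X in _ * X]memN_msupp_eq0 ?mulr0 //.
  by apply: msize_mdeg_ge; apply: leq_trans (sizeF a) gem.
have := congr1 (fun v : 'rV_ _ => v 0 (enum_rank (BMultinom ltm))) uB.
rewrite !mxE => uB0; rewrite -[RHS]uB0 (reindex (@enum_val _ {: I})) /=; last first.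
  by exists enum_rank => x _; rewrite ?enum_valK ?enum_rankK.
apply: eq_bigr => j _.
by rewrite !mxE mmapZ mmapX mcoeffCM enum_valK enum_rankK.
Qed.
End AlgebraicDependence.

(** * Polynomial functions and the Zariski topology *)

Section ZariskiBasics.
Variables (K : closedFieldType) (V : vectType K).
Implicit Types (p q : {mpoly K[\dim {:V}]}) (Z : set V) (f g : V -> K).
Local Notation cd := (coord (vbasis {:V})).

Lemma peval_ring_ind (Q : (V -> K) -> Prop) :
    (forall c, Q (fun=> c)) -> (forall i, Q (cd i)) ->
    (forall f g, Q f -> Q g -> Q (fun v => f v + g v)) ->
    (forall f g, Q f -> Q g -> Q (fun v => f v * g v)) ->
  forall p, Q (peval p).
Proof.
move=> QC QX QD QM; elim/mpoly_ring_ind => [c|i|p q Qp Qq|p q Qp Qq].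
- by have := QC c; congr Q; apply/funext => v; rewrite /peval mevalC.
- by have := QX i; congr Q; apply/funext => v; rewrite /peval mevalXU.
- by have := QD _ _ Qp Qq; congr Q; apply/funext => v; rewrite /peval mevalD.
- by have := QM _ _ Qp Qq; congr Q; apply/funext => v; rewrite /peval mevalM.
Qed.

Definition polyfun f := exists p, f = peval p.

Lemma polyfun_peval p : polyfun (peval p). Proof. by exists p. Qed.

Lemma polyfunC c : polyfun (fun=> c).
Proof. by exists c%:MP; apply/funext => v; rewrite /peval mevalC. Qed.

Lemma polyfun_coord i : polyfun (cd i).
Proof. by exists 'X_i; apply/funext => v; rewrite /peval mevalXU. Qed.

Lemma polyfunD f g : polyfun f -> polyfun g -> polyfun (fun v => f v + g v).
Proof.
by move=> [p ->] [q ->]; exists (p + q); apply/funext => v; rewrite /peval mevalD.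
Qed.

Lemma polyfunM f g : polyfun f -> polyfun g -> polyfun (fun v => f v * g v).
Proof.
by move=> [p ->] [q ->]; exists (p * q); apply/funext => v; rewrite /peval mevalM.
Qed.

Lemma polyfun_linear (W : vectType K) (w : 'Hom(V, W)) (c : {linear W -> K^o}) :
  polyfun (fun v => c (w v)).
Proof.
have -> : (fun v => c (w v)) =
    (fun v => \sum_(i < \dim {:V}) cd i v * c (w (vbasis {:V})`_i)).
  apply/funext => v; rewrite {1}(coord_vbasis (memvf v)) !linear_sum.
  by apply: eq_bigr => i _; rewrite !linearZ.
elim: (index_enum _) => [|i r IHr].
  have -> : (fun v => \sum_(i <- [::]) cd i v * c (w (vbasis {:V})`_i)) = (fun=> 0).
    by apply/funext => v; rewrite big_nil.
  exact: polyfunC.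
have -> : (fun v => \sum_(j <- i :: r) cd j v * c (w (vbasis {:V})`_j)) =
    (fun v => cd i v * c (w (vbasis {:V})`_i) +
              \sum_(j <- r) cd j v * c (w (vbasis {:V})`_j)).
  by apply/funext => v; rewrite big_cons.
by apply: polyfunD => //; apply: polyfunM; [apply: polyfun_coord|apply: polyfunC].
Qed.

Lemma polyfun_hom (h : 'Hom(V, K^o)) : polyfun (h : V -> K).
Proof. exact: (polyfun_linear h (idfun : {linear K^o -> K^o})). Qed.

Lemma polyfun_comp f (G : V -> V) :
  polyfun f -> (forall i, polyfun (fun v => cd i (G v))) -> polyfun (fun v => f (G v)).
Proof.
move=> [p ->] pG; pattern (peval p); apply: peval_ring_ind p => //.
- by move=> c; apply: polyfunC.
- by move=> f1 g1; apply: polyfunD.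
- by move=> f1 g1; apply: polyfunM.
Qed.

Lemma polyfun_affine f a w : polyfun f -> polyfun (fun v => f (a *: v + w)).
Proof.
move=> pf; apply: polyfun_comp => // i.
have -> : (fun v => cd i (a *: v + w)) = (fun v => a * cd i v + cd i w).
  by apply/funext => v; rewrite linearP.
apply: polyfunD; last exact: polyfunC.
by apply: polyfunM; [apply: polyfunC|apply: polyfun_coord].
Qed.

Lemma peval_line p a d : exists P : {poly K}, forall t, peval p (a + t *: d) = P.[t].
Proof.
pattern (peval p); apply: peval_ring_ind p => [c|i|f g [P fP] [Q gQ]|f g [P fP] [Q gQ]].
- by exists c%:P => t; rewrite hornerC.
- exists ((cd i d)%:P * 'X + (cd i a)%:P) => t.
  by rewrite linearD linearZ /= !hornerE addrC mulrC.
- by exists (P + Q) => t; rewrite hornerD fP gQ.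
- by exists (P * Q) => t; rewrite hornerM fP gQ.
Qed.

(** The functions vanishing on [Z] form the largest family that could define it, so closedness can
    be tested on it without exhibiting equations. *)
Lemma zclosedP Z : zclosed Z <->
  forall v, (forall f, polyfun f -> (forall z, Z z -> f z = 0) -> f v = 0) -> Z v.
Proof.
split=> [[S ->] v vP p Sp|ZP].
  by apply: (vP (peval p)) => [|z /(_ p Sp)//]; apply: polyfun_peval.
exists [set p | forall z, Z z -> peval p z = 0]; rewrite eqEsubset.
split=> [z Zz p|v vP]; first exact.
by apply: ZP => _ [p ->]; apply: vP.
Qed.

Lemma zclosed_zeros f : polyfun f -> zclosed [set v | f v = 0].
Proof. by move=> pf; apply/zclosedP => v; apply. Qed.

Lemma zclosedI Z Z' : zclosed Z -> zclosed Z' -> zclosed (Z `&` Z').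
Proof.
move=> /zclosedP cZ /zclosedP cZ'; apply/zclosedP => v vP.
by split; [apply: cZ|apply: cZ'] => f pf fZ; apply: vP => // z []; auto.
Qed.

Lemma zclosed_bigcap (I : Type) (F : I -> set V) :
  (forall i, zclosed (F i)) -> zclosed [set v | forall i, F i v].
Proof.
move=> cF; apply/zclosedP => v vP i; have /zclosedP := cF i; apply=> f pf fF.
by apply: vP => // z; move/(_ i)/fF.
Qed.

Lemma zclosed_affine Z a w : zclosed Z -> zclosed [set v | Z (a *: v + w)].
Proof.
move=> /zclosedP cZ; apply/zclosedP => v vP; apply: cZ => f pf fZ.
by apply: (vP (fun u => f (a *: u + w))) => [|z /fZ //]; apply: polyfun_affine.
Qed.

Lemma zclosureP Z v : zclosure Z v <->
  forall f, polyfun f -> (forall z, Z z -> f z = 0) -> f v = 0.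
Proof.
split=> [Zv f pf fZ|vP]; last first.
  by move=> C [/zclosedP cC ZC]; apply: cC => f pf fC; apply: vP => // z /ZC/fC.
by have := Zv [set v | f v = 0]; apply; split=> //; apply: zclosed_zeros.
Qed.

Lemma zclosed_closure Z : zclosed (zclosure Z).
Proof.
apply/zclosedP => v vP; apply/zclosureP => f pf fZ; apply: vP => // z.
by move/zclosureP; apply.
Qed.

Lemma sub_zclosure Z : Z `<=` zclosure Z.
Proof. by move=> z Zz; apply/zclosureP => f _; apply. Qed.

Lemma zclosure_min Z C : zclosed C -> Z `<=` C -> zclosure Z `<=` C.
Proof. by move=> cC ZC v; apply. Qed.

(** Primality of the vanishing ideal. If [Z] leaves both [A] and [B], an equation of each that fails
    somewhere on [Z] gives two functions with zero product on [Z], neither vanishing on [Z]. *)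
Lemma zirreducibleP Z : zirreducible Z <-> Z !=set0 /\
  forall f g, polyfun f -> polyfun g -> (forall z, Z z -> f z * g z = 0) ->
    (forall z, Z z -> f z = 0) \/ (forall z, Z z -> g z = 0).
Proof.
split=> -[Z0 ZP]; split=> //.
  move=> f g pf pg fg; apply: (ZP [set v | f v = 0] [set v | g v = 0]).
  - exact: zclosed_zeros.
  - exact: zclosed_zeros.
  by move=> z /fg/eqP; rewrite mulf_eq0 => /orP[] /eqP; [left|right].
move=> A B [S ->] [S' ->] ZAB; apply: contrapT => /not_orP[].
move=> /existsNP[a /not_implyP[Za /existsNP[p /not_implyP[Sp pa]]]].
move=> /existsNP[b /not_implyP[Zb /existsNP[q /not_implyP[Sq qb]]]].
have [] := ZP _ _ (polyfun_peval p) (polyfun_peval q).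
- by move=> z /ZAB[/(_ _ Sp)|/(_ _ Sq)] ->; rewrite (mul0r, mulr0).
- by move/(_ _ Za).
- by move/(_ _ Zb).
Qed.

Lemma zirreducible_closure Z : zirreducible Z -> zirreducible (zclosure Z).
Proof.
move=> /zirreducibleP[[z Zz] ZP]; apply/zirreducibleP; split.
  by exists z; apply: sub_zclosure.
move=> f g pf pg fg.
have [z' Zz'|h|h] := ZP f g pf pg; first by apply: fg; apply: sub_zclosure.
- by left => y /zclosureP yP; apply: yP.
- by right => y /zclosureP yP; apply: yP.
Qed.

Lemma zirreducible_affine Z a w : a != 0 -> zirreducible Z ->
  zirreducible [set v | Z (a *: v + w)].
Proof.
move=> a0 /zirreducibleP[[z0 Zz0] ZP].
have aK v : a *: (a^-1 *: v - a^-1 *: w) + w = v.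
  by rewrite scalerBr !scalerA divff // !scale1r subrK.
have Ka v : a^-1 *: (a *: v + w) - a^-1 *: w = v.
  by rewrite scalerDr scalerA mulVf // scale1r addrK.
apply/zirreducibleP; split.
  by exists (a^-1 *: z0 - a^-1 *: w); rewrite /= aK.
move=> f g pf pg fg.
have [||z Zz|h|h] := ZP (fun v => f (a^-1 *: v - a^-1 *: w))
                  (fun v => g (a^-1 *: v - a^-1 *: w)).
- exact: polyfun_affine.
- exact: polyfun_affine.
- by apply: fg; rewrite /= aK.
- by left => v Zv; rewrite -[v]Ka h.
- by right => v Zv; rewrite -[v]Ka h.
Qed.

(* Restricting a product f g = 0 to the line through a point with f <> 0 and a
   point with g <> 0 gives two nonzero univariate polynomials with product 0. *)
Lemma zirreducible_lines Z : Z !=set0 ->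
  (forall a b t, Z a -> Z b -> Z (a + t *: (b - a))) -> zirreducible Z.
Proof.
move=> Z0 lZ; apply/zirreducibleP; split=> // _ _ [p ->] [q ->] pq.
apply: contrapT => /not_orP[/existsNP[a /not_implyP[Za pa]]].
move=> /existsNP[b /not_implyP[Zb qb]].
have [P pP] := peval_line p a (b - a); have [Q qQ] := peval_line q a (b - a).
have : P * Q != 0.
  rewrite mulf_eq0 negb_or; apply/andP; split; apply/eqP => e.
    by apply: pa; have := pP 0; rewrite scale0r addr0 e horner0.
  by apply: qb; have := qQ 1; rewrite scale1r addrC subrK e horner0.
case/closed_nonrootP => t /rootP; case.
by rewrite hornerM -pP -qQ pq //; apply: lZ.
Qed.

(** A subspace inside [P] of least codimension is all of [P], since otherwise the line of a missing
    vector could be adjoined. *)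
Lemma vspace_of_pred (P : V -> Prop) :
    P 0 -> (forall v w, P v -> P w -> P (v + w)) ->
    (forall a v, P v -> P (a *: v)) ->
  exists U : {vspace V}, forall v, P v <-> v \in U.
Proof.
move=> P0 PD PZ.
have [|U UP maxU] := @ex_least_measure {vspace V} (fun U => \dim {:V} - \dim U)%N
  (fun U => forall v, v \in U -> P v) 0%VS.
  by move=> v; rewrite memv0 => /eqP ->.
exists U => v; split=> [Pv|]; last exact: UP.
apply: contraT => nUv.
have /maxU : forall w, w \in (U + <[v]>)%VS -> P w.
  move=> w /memv_addP[u Uu [_ /vlineP[a ->] ->]].
  by apply: PD; [apply: UP|apply: PZ].
have le : (\dim (U + <[v]>) <= \dim {:V})%N by rewrite dimvS ?subvf.
have lt : (\dim U < \dim (U + <[v]>))%N.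
  rewrite ltn_neqAle dimvS ?addvSl // andbT.
  rewrite (dimv_leqif_eq (addvSl U <[v]>)); apply/eqP => e.
  by case/negP: nUv; rewrite e; apply: (subvP (addvSr _ _)); apply: memv_line.
by rewrite leqNgt ltn_sub2l // (leq_trans lt).
Qed.

(** [U] is the kernel of [\1 - projv U], whose coordinates are linear equations for it. *)
Lemma zclosed_vspace (U : {vspace V}) : zclosed [set v | v \in U].
Proof.
have wE v : (\1 - projv U)%VF v = v - projv U v.
  by rewrite add_lfunE opp_lfunE id_lfunE.
have -> : [set v | v \in U] =
    [set v | forall i, cd i ((\1 - projv U)%VF v) = 0].
  rewrite eqEsubset; split=> v /=.
    by move=> Uv i; rewrite wE projv_id // subrr linear0.
  move=> cv; have : v - projv U v = 0.
    rewrite (coord_vbasis (memvf (v - _))) big1 // => i _.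
    by have := cv i; rewrite wE => ->; rewrite scale0r.
  by move/eqP; rewrite subr_eq0 => /eqP ->; apply: memv_proj.
by apply: zclosed_bigcap => i; apply/zclosed_zeros/polyfun_linear.
Qed.

End ZariskiBasics.

(** * Krull dimension *)

Lemma meval_mmapC (K : comNzRingType) (m n : nat) (f : 'I_m -> {mpoly K[n]})
    (P : {mpoly K[m]}) (v : 'I_n -> K) :
  (mmap (@mpolyC n K) f P).@[v] = P.@[fun i => (f i).@[v]].
Proof.
elim/mpoly_ring_ind: P => [c|i|P Q|P Q].
- by rewrite mmapC /= !mevalC.
- by rewrite mmapX mmap1U mevalXU.
- by rewrite rmorphD /= !mevalD => -> ->.
- by rewrite rmorphM /= !mevalM => -> ->.
Qed.

(** Isolates the part [c] free of the first variable: it is what remains of a relation where the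
    first argument vanishes. *)
Lemma mpoly_split0 (K : comNzRingType) (r : nat) (P : {mpoly K[r.+1]}) :
  exists c Q, P =
    mmap (@mpolyC r.+1 K) (fun i : 'I_r => 'X_(lift ord0 i)) c + 'X_ord0 * Q.
Proof.
elim/mpoly_ring_ind: P => [a|i|P P' [c [Q ->]] [c' [Q' ->]]|
                           P P' [c [Q ->]] [c' [Q' ->]]].
- by exists a%:MP, 0; rewrite mmapC mulr0 addr0.
- have [j ->|->] := unliftP ord0 i.
    by exists 'X_j, 0; rewrite mmapX mmap1U mulr0 addr0.
  by exists 0, 1; rewrite raddf0 mulr1 add0r.
- by exists (c + c'), (Q + Q'); rewrite rmorphD /= mulrDr addrACA.
- set E := mmap _ _.
  exists (c * c'), (E c * Q' + Q * E c' + 'X_ord0 * Q * Q').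
  rewrite /E rmorphM /= -/E; ring.
Qed.

Section Dimension.
Variables (K : closedFieldType) (V : vectType K).
Local Notation n := (\dim {:V}).
Implicit Types (Z : set V) (C : nat -> set V).

(** Algebraic independence over [K] of the restrictions to [Z]. *)
Definition alg_indep Z (r : nat) (f : 'I_r -> {mpoly K[n]}) :=
  forall P : {mpoly K[r]}, P != 0 ->
    exists2 z, Z z & P.@[fun i => peval (f i) z] <> 0.

(* A nonzero relation P(g, f) = 0 on Z' of least degree is c(f) + g Q(g, f);
   on Z it reads c(f) = 0, so c = 0 and g, then Q, can be cancelled. *)
Lemma alg_indep_step Z Z' r (f : 'I_r -> {mpoly K[n]}) g :
    alg_indep Z f -> Z `<=` Z' -> zirreducible Z' ->
    (forall z, Z z -> peval g z = 0) -> ~ (forall z, Z' z -> peval g z = 0) ->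
  alg_indep Z' (first_var g f).
Proof.
move=> indf ZZ' /zirreducibleP[_ Zirr] g0 gn0 P0 P0n0; apply: contrapT => P0z.
pose ev z := fun i => peval (first_var g f i) z.
have P0ev z : Z' z -> P0.@[ev z] = 0.
  by move=> Zz; apply: contrapT => Pz; apply: P0z; exists z.
have [P [Pn0 Pz] minP] := @ex_least_measure {mpoly K[r.+1]} (fun P => msize P)
  (fun P => P != 0 /\ forall z, Z' z -> P.@[ev z] = 0) P0
  (conj P0n0 P0ev).
have [c [Q PE]] := mpoly_split0 P.
have evP z : P.@[ev z] = c.@[fun i => peval (f i) z] + peval g z * Q.@[ev z].
  rewrite PE mevalD mevalM mevalXU meval_mmapC {2}/ev /first_var unlift_none.
  congr (_ + _); apply: meval_eq => i; rewrite mevalXU.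
  by rewrite /ev /first_var liftK.
have c0 : c = 0.
  apply/eqP; apply: contraT => /indf[z Zz] [].
  by rewrite -(Pz z (ZZ' z Zz)) evP g0 // mul0r addr0.
move: PE; rewrite c0 raddf0 add0r => PE.
have Qn0 : Q != 0 by apply: contraNneq Pn0 => Q0; rewrite PE Q0 mulr0.
have pQ : polyfun (fun z => Q.@[ev z]).
  exists (mmap (@mpolyC n K) (first_var g f) Q); apply/funext => z.
  by rewrite /peval meval_mmapC.
have [z Zz|//|Qz] := Zirr _ _ (polyfun_peval g) pQ.
  by rewrite -(Pz z Zz) evP c0 meval0 add0r.
have := minP Q (conj Qn0 Qz).
have Xn0 : 'X_ord0 != 0 :> {mpoly K[r.+1]}.
  by apply: contraNneq Pn0 => X0; rewrite PE X0 mul0r.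
by rewrite PE msizeM // msizeX mdeg1 /= ltnn.
Qed.

Lemma zchain_leq_dim Z d C : zchain Z d C -> (d <= n)%N.
Proof.
move=> [Cirr Clt]; rewrite leqNgt; apply/negP => ltd.
have indep i : (i <= d)%N -> exists f : 'I_i -> {mpoly K[n]}, alg_indep (C i) f.
  elim: i => [_|i IHi ltid].
    (* A nonzero polynomial in no variables is a nonzero constant, so any point of [C 0] will do. *)
    exists (fun _ => 0) => P Pn0.
    have [_ [[z Cz] _] _] := Cirr 0 isT; exists z => //.
    have [c cP] := mpoly0_const P.
    by move: Pn0; rewrite cP mpolyC_eq0 mevalC => /eqP.
  have [f indf] := IHi (ltnW ltid).
  have [subC nsubC] := Clt i ltid; have [_ irrC _] := Cirr i.+1 ltid.
  have [[S CE] _ _] := Cirr i (ltnW ltid).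
  have [z [Cz nCz]] : exists z, C i.+1 z /\ ~ C i z.
    by move/existsNP: nsubC => [z /not_implyP]; exists z.
  move: nCz; rewrite {1}CE => /existsNP[g /not_implyP[Sg gz]].
  exists (first_var g f); apply: (alg_indep_step indf) => // [y|/(_ z Cz)//].
  by rewrite CE; apply.
(* [ltd] reads [n.+1 <= d], so [C n.+1] carries [n.+1] independent polynomials in [n] variables. *)
have [f indf] := indep _ ltd.
have [P Pn0 Pf] := algebraic_dependence f.
by have [z _] := indf _ Pn0; case; rewrite -meval_mmapC Pf meval0.
Qed.

Lemma has_zdim_fun Z d d' : has_zdim Z d -> has_zdim Z d' -> d = d'.
Proof.
move=> [[C chC] maxd] [[C' chC'] maxd'].
by apply/eqP; rewrite eqn_leq (maxd _ _ chC') (maxd' _ _ chC).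
Qed.

Lemma has_zdim_ex Z : zclosed Z -> zirreducible Z -> exists d, has_zdim Z d.
Proof.
move=> cZ irrZ; pose S d := `[< exists C, zchain Z d C >].
have exS : exists d, S d.
  exists 0%N; apply/asboolP; exists (fun=> Z).
  by split=> // i _; split.
have bS d : S d -> (d <= n)%N by move/asboolP => [C]; apply: zchain_leq_dim.
case: (ex_maxnP exS bS) => d /asboolP chC maxd; exists d; split=> // e C chC'.
by apply: maxd; apply/asboolP; exists C.
Qed.

Lemma zchain_extend Z Z' d C : zchain Z d C -> Z `<` Z' ->
  zclosed Z' -> zirreducible Z' ->
  zchain Z' d.+1 (fun i => if (i <= d)%N then C i else Z').
Proof.
move=> [Cirr Clt] [ZZ' nZZ'] cZ' irrZ'; split=> i.
  move=> _; case: leqP => [leid|_]; last by split.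
  by have [cC iC sC] := Cirr i leid; split=> //; apply: subset_trans ZZ'.
rewrite /= ltnS; case: ltngtP => // [ltid _|-> _]; first exact: Clt.
have [_ _ sC] := Cirr d (leqnn d).
split; first exact: subset_trans ZZ'.
by move=> Z'C; apply: nZZ'; apply: subset_trans sC.
Qed.

Lemma zchain_affine Z d C a w : a != 0 -> zchain Z d C ->
  zchain [set v | Z (a *: v + w)] d (fun i => [set v | C i (a *: v + w)]).
Proof.
move=> a0 [Cirr Clt]; split=> i /= leid.
  have [cC iC sC] := Cirr i leid; split; first exact: zclosed_affine.
    exact: zirreducible_affine.
  by move=> v; apply: sC.
have [sC nC] := Clt i leid; split=> [v|sC']; first exact: sC.
apply: nC => v Cv; have := sC' (a^-1 *: (v - w)).
by rewrite /= scalerA divff // scale1r subrK; apply.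
Qed.

(** * Hyperplanes and their dimension *)

Lemma hyperplane_point (h : 'Hom(V, K^o)) (c : K) : h != 0 -> exists v, h v = c.
Proof.
move=> h0; have [v hv] : exists v, h v != 0.
  apply: contrapT => /forallNP hv; case/eqP: h0; apply/lfunP => v.
  by rewrite zero_lfunE; apply/eqP/negPn/negP.
by exists ((c / h v) *: v); rewrite linearZ /= /GRing.scale /= divfK.
Qed.

Lemma zclosed_hyperplane (h : 'Hom(V, K^o)) (c : K) : zclosed [set v | h v = c].
Proof.
have -> : [set v | h v = c] = [set v | h v + - c = 0].
  rewrite eqEsubset; split=> v /= => [->|/eqP]; first by rewrite subrr.
  by rewrite subr_eq0 => /eqP.
apply: zclosed_zeros; apply: polyfunD; last exact: polyfunC.
exact: polyfun_hom.
Qed.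

Lemma zirreducible_hyperplane (h : 'Hom(V, K^o)) (c : K) : h != 0 ->
  zirreducible [set v | h v = c].
Proof.
move=> h0; apply: zirreducible_lines; first exact: hyperplane_point.
by move=> a b t /= ha hb; rewrite linearD linearZ linearB /= ha hb subrr scaler0 addr0.
Qed.

(** A flag of [ker h] translated by [v0] gives a chain of the required length. Any chain in the
    hyperplane can be extended by the whole space, where chains have length at most [n]. *)
Lemma has_zdim_hyperplane (h : 'Hom(V, K^o)) (c : K) : h != 0 ->
  has_zdim [set v | h v = c] n.-1.
Proof.
move=> h0; have [v0 hv0] := hyperplane_point c h0.
have dker : \dim (lker h) = n.-1.
  have := limg_ker_dim h fullv; rewrite capfv.
  have -> : \dim (h @: fullv) = 1%N; last by rewrite addn1 => <-.
  apply/eqP; rewrite eqn_leq; apply/andP; split.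
    by rewrite (leq_trans (dimvS (subvf _))) // dimvf.
  rewrite lt0n dimv_eq0; apply: contraNneq h0 => im0; apply/eqP/lfunP => v.
  by rewrite zero_lfunE; apply/eqP; rewrite -memv0 -im0 memv_img ?memvf.
split.
  pose U i := <<take i (vbasis (lker h))>>%VS.
  have Uker i : (U i <= lker h)%VS.
    rewrite -(span_basis (vbasisP (lker h))); apply: sub_span => x.
    exact: mem_take.
  have dimU i : (i <= n.-1)%N -> \dim (U i) = i.
    move=> le; have fr : free (take i (vbasis (lker h))).
      have := basis_free (vbasisP (lker h)).
      by rewrite -[X in free X](cat_take_drop i) cat_free => /and3P[].
    by have := fr; rewrite /free => /eqP ->; rewrite size_take_min size_tuple dker; apply/minn_idPl.
  exists (fun i => [set v | v - v0 \in U i]); split=> i lei.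
    split.
    - have := @zclosed_affine _ _ _ 1 (- v0) (zclosed_vspace (U i)).
      by congr zclosed; apply/funext => v /=; rewrite scale1r.
    - apply: zirreducible_lines; first by exists v0; rewrite /= subrr mem0v.
      move=> a b t /= Ua Ub.
      have -> : a + t *: (b - a) - v0 = (a - v0) + t *: ((b - v0) - (a - v0)).
        by rewrite opprB addrA subrK addrAC.
      by apply: memvD => //; apply: memvZ; apply: memvB.
    - move=> v /= /(subvP (Uker i)); rewrite memv_ker linearB /= hv0.
      by rewrite subr_eq0 => /eqP.
  split=> [v /=|sU].
    apply/subvP; apply: sub_span => x; rewrite (take_nth 0) ?mem_rcons ?inE.
      by move=> ->; rewrite orbT.
    by rewrite size_tuple dker.
  have /dimvS : (U i.+1 <= U i)%VS.
    by apply/subvP => v Uv; have := sU (v + v0); rewrite /= addrK; apply.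
  by rewrite !dimU ?ltnn // ltnW.
move=> e C chC.
have irrV : zirreducible [set: V] by apply: zirreducible_lines => //; exists 0.
have cV : zclosed [set: V] by apply/zclosedP.
have ltV : [set v | h v = c] `<` [set: V].
  split=> // sub; have [v hv] := hyperplane_point (c + 1) h0.
  have := sub v I; rewrite /= hv => /eqP.
  by rewrite -[X in _ == X]addr0 (inj_eq (addrI c)) oner_eq0.
by have := zchain_leq_dim (zchain_extend chC ltV cV irrV); case: (n).
Qed.

End Dimension.

(** * Secant varieties *)

Definition mpolyC2 (K A : comNzRingType) (C : {rmorphism K -> A}) (N : nat) :
  {rmorphism K -> {mpoly A[N]}} := @mpolyC N A \o C.

(** Lets an equation over [K] in the [n] coordinates of one point be read as a relation over [A]
    among the [N] coordinates of all points. *)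
Lemma mmap_mpolyC2 (K A : comNzRingType) (C : {rmorphism K -> A})
    (phi : {rmorphism A -> K}) (n N : nat) (r : 'I_n -> 'I_N) (s : 'I_N -> K)
    (p : {mpoly K[n]}) : (forall c, phi (C c) = c) ->
  mmap phi s (mmap (mpolyC2 C N) (fun j => 'X_(r j)) p) = p.@[fun j => s (r j)].
Proof.
move=> phiC; elim/mpoly_ring_ind: p => [c|j|p1 p2|p1 p2].
- by rewrite mmapC /= mmapC /= phiC mevalC.
- by rewrite mmapX mmap1U mmapX mmap1U mevalXU.
- by rewrite !mmapD mevalD => -> ->.
- by rewrite !rmorphM /= => -> ->.
Qed.

Section Secants.
Variables (K : closedFieldType) (V : vectType K).
Local Notation n := (\dim {:V}).
Local Notation cd := (coord (vbasis {:V})).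
Implicit Types (A : set V) (k : nat).

Definition upd k (y : 'I_k -> V) (i : 'I_k) (v : V) : 'I_k -> V :=
  fun j => if j == i then v else y j.

Definition points k A : set ('I_k -> V) := [set y | forall i, A (y i)].

(** Polynomiality in each point separately is all that the irreducibility argument uses; it avoids
    coordinates on the [k]-fold product of [V]. *)
Definition sep_poly k : set (('I_k -> V) -> K) :=
  [set f | forall y i, polyfun (fun v => f (upd y i v))].

Lemma upd_id k (y : 'I_k -> V) i : upd y i (y i) = y.
Proof. by apply/funext => j; rewrite /upd; case: eqP => // ->. Qed.

Lemma sep_poly_sum k (f : V -> K) : polyfun f -> @sep_poly k (fun y => f (\sum_i y i)).
Proof.
move=> pf y i; have := polyfun_affine 1 (\sum_(j | j != i) y j) pf.
congr polyfun; apply/funext => v; congr f.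
rewrite [RHS](bigD1 i) //= [X in _ = X + _]/upd eqxx scale1r; congr (_ + _).
by apply: eq_bigr => j /negPf ji; rewrite /upd ji.
Qed.

(** Irreducibility of the product of [k] copies of [A], by freeing one point at a time. *)
Lemma sep_poly_domain k A (f g : ('I_k -> V) -> K) : zirreducible A ->
    sep_poly f -> sep_poly g -> (forall y, points A y -> f y * g y = 0) ->
  (forall y, points A y -> f y = 0) \/ (forall y, points A y -> g y = 0).
Proof.
move=> [[a0 Aa0] irrA] sf sg fg.
(* The first [m] points are free in [A], the others are those of [z]. *)
pose slice m z : set ('I_k -> V) :=
  [set y | points A y /\ forall i : 'I_k, (m <= i)%N -> y i = z i].
have slice_domain m z : (m <= k)%N -> points A z ->
    (forall y, slice m z y -> f y = 0) \/ (forall y, slice m z y -> g y = 0).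
  elim: m z => [|m IHm] z ltmk Az.
    have /eqP := fg z Az; rewrite mulf_eq0 => /orP[] /eqP fz; [left|right];
      by move=> y [_ yz]; rewrite -fz; congr (_ _); apply/funext => i; apply: yz.
  pose i0 := Ordinal ltmk.
  have Aupd y v : A v -> points A y -> points A (upd y i0 v).
    by move=> Av Ay i; rewrite /upd; case: eqP.
  (* For each value [v] in [A] of the newly freed point, the induction hypothesis puts [v] in [B f]
     or [B g]; both are closed, so irreducibility of [A] makes one of them contain [A]. *)
  pose B (h : ('I_k -> V) -> K) :=
    [set v | forall y, slice m.+1 z y -> h (upd y i0 v) = 0].
  have cB h : sep_poly h -> zclosed (B h).
    move=> sh; apply/zclosedP => v vP y yz.
    by apply: (vP (fun v => h (upd y i0 v))) => // w; apply.
  have BE h : A `<=` B h -> forall y, slice m.+1 z y -> h y = 0.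
    by move=> AB y ys; have := AB (y i0) (ys.1 i0) y ys; rewrite upd_id.
  have [v Av||] := irrA (B f) (B g) (cB f sf) (cB g sg); last 2 first.
  - by move/BE; left.
  - by move/BE; right.
  have sub y : slice m.+1 z y -> slice m (upd z i0 v) (upd y i0 v).
    move=> [Ay yz]; split=> [|i lemi]; first exact: Aupd.
    rewrite /upd; case: eqP => // /eqP ii0; apply: yz.
    by rewrite ltn_neqAle lemi andbT eq_sym.
  by have [h|h] := IHm (upd z i0 v) (ltnW ltmk) (Aupd z v Av Az); [left|right];
    move=> y /sub/h.
have [h|h] := slice_domain k (fun=> a0) (leqnn k) (fun=> Aa0); [left|right];
  by move=> y Ay; apply: h; split=> // i; rewrite leqNgt ltn_ord.
Qed.

Lemma zirreducible_open_secant k A :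
  zirreducible A -> zirreducible (open_secant k A).
Proof.
move=> irrA; have [[a0 Aa0] _] := irrA; apply/zirreducibleP; split.
  by exists (\sum_(i < k) a0); exists (fun=> a0).
move=> f g pf pg fg.
have [y Ay|h|h] := sep_poly_domain irrA (sep_poly_sum (k := k) pf) (sep_poly_sum pg).
- by apply: fg; exists y.
- by left => _ [y Ay ->]; apply: h.
- by right => _ [y Ay ->]; apply: h.
Qed.

(** Elimination applied to [k]-tuples in [A]: the base ring is that of polynomials on [V], evaluated
    at the sum, and the coordinates to eliminate are those of all the points. *)
Lemma open_secant_dense k A : zclosed A -> zirreducible A ->
  exists f, [/\ polyfun f, exists2 v, open_secant k A v & f v != 0 &
    forall v, secant k A v -> f v != 0 -> open_secant k A v].
Proof.
move=> [S AE] irrA; have [[a0 Aa0] _] := irrA.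
pose e (y : 'I_k -> V) : {rmorphism {mpoly K[n]} -> K} :=
  meval (fun j => cd j (\sum_i y i)).
pose N := #|{: 'I_k * 'I_n}|.
pose x (m : 'I_N) (y : 'I_k -> V) := cd (enum_val m).2 (y (enum_val m).1).
have sx m : sep_poly (x m).
  move=> y i; rewrite /x /upd; case: eqP => _; [exact: polyfun_coord|exact: polyfunC].
have sD f g : @sep_poly k f -> sep_poly g -> sep_poly (fun y => f y + g y).
  by move=> sf sg y i; apply: polyfunD; [apply: sf|apply: sg].
have sM f g : @sep_poly k f -> sep_poly g -> sep_poly (fun y => f y * g y).
  by move=> sf sg y i; apply: polyfunM; [apply: sf|apply: sg].
have se a : sep_poly (fun y => e y a) := sep_poly_sum (polyfun_peval a).
have Y0 : @points k A !=set0 by exists (fun=> a0).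
have [a an0 aP] := elimination Y0 sD sM
  (fun f g sf sg => sep_poly_domain irrA sf sg) se sx.
exists (peval a); split; first exact: polyfun_peval.
  have /existsNP[y /not_implyP[Ay /eqP ay]] := an0.
  by exists (\sum_i y i) => //; exists y.
move=> v Sv av.
(* As [v] lies in the closure, evaluation at [v] kills every polynomial that vanishes on the sums,
   so it extends to values [t] for the coordinates of the points. *)
have [c cY|//|t tP] := aP (meval (fun j => cd j v)).
  have /zclosureP/(_ (peval c)) := Sv; apply; first exact: polyfun_peval.
  by move=> _ [y Ay ->]; apply: cY.
pose y i := \sum_j t (enum_rank (i, j)) *: (vbasis {:V})`_j.
have cdy i j : cd j (y i) = t (enum_rank (i, j)).
  by rewrite /y coord_sum_free // (basis_free (vbasisP _)).
exists y => [i|].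
  rewrite AE => p Sp.
  (* The equation [p] of [A] written in the coordinates of the [i]-th point. *)
  pose q := mmap (mpolyC2 (@mpolyC n K) N) (fun j => 'X_(enum_rank (i, j))) p.
  have qE w s : mmap (meval w) s q = p.@[fun j => s (enum_rank (i, j))].
    by apply: mmap_mpolyC2 => c; apply: mevalC.
  have : mmap (meval (cd^~ v)) t q = 0.
    apply: tP => z Az; rewrite qE.
    have := Az i; rewrite AE => /(_ p Sp) <-; rewrite /peval.
    by apply: meval_eq => j; rewrite /x enum_rankK.
  rewrite qE => <-.
  by apply: meval_eq => j; rewrite cdy.
rewrite (coord_vbasis (memvf v)) (coord_vbasis (memvf (\sum_i y i))).
apply: eq_bigr => j _; congr (_ *: _); rewrite linear_sum /=.
(* The relation saying that the points add up to the base point holds on all tuples, hence also at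
   [t]. *)
have : mmap (meval (cd^~ v)) t
    (\sum_i 'X_(enum_rank (i, j)) - ('X_j : {mpoly K[n]})%:MP) = 0.
  apply: tP => z Az; rewrite rmorphB raddf_sum /= mmapC /= mevalXU linear_sum.
  apply/eqP; rewrite subr_eq0; apply/eqP; apply: eq_bigr => i _.
  by rewrite mmapX mmap1U /x enum_rankK.
rewrite rmorphB raddf_sum /= mmapC /= mevalXU => /eqP; rewrite subr_eq0 => /eqP <-.
by apply: eq_bigr => i _; rewrite mmapX mmap1U cdy.
Qed.

End Secants.

(** * Secant varieties of a hyperplane section of a cone *)

(** In characteristic zero the first [size P] natural numbers are distinct in [K], one root too many
    for a nonzero [P]. *)
Lemma pchar0_poly_eq0 (K : fieldType) (P : {poly K}) : [pchar K] =i pred0 ->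
  (forall m : nat, P.[m%:R] = 0) -> P = 0.
Proof.
move=> charK Pm; apply/eqP; apply: contraT => Pn0.
have := @max_poly_roots K P [seq m%:R | m <- iota 0 (size P)] Pn0.
rewrite size_map size_iota ltnn; apply.
  by apply/allP => _ /mapP[m _ ->]; apply/rootP.
rewrite map_inj_uniq ?iota_uniq // => i j /eqP.
wlog leij : i j / (i <= j)%N => [wlg|].
  by case/orP: (leq_total i j) => le; [|rewrite eq_sym]; move=> /(wlg _ _ le).
rewrite eq_sym -subr_eq0 -natrB // ((pcharf0P K).1 charK) subn_eq0 => leji.
by apply/eqP; rewrite eqn_leq leij.
Qed.

Section SecantsOfCone.
Variables (K : closedFieldType) (V : vectType K).
Implicit Types (A X : set V) (k : nat) (h : 'Hom(V, K^o)).

Lemma open_secantD j k A u v :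
  open_secant j A u -> open_secant k A v -> open_secant (j + k) A (u + v).
Proof.
move=> [p Ap ->] [q Aq ->].
exists (fun i => match split i with inl i1 => p i1 | inr i2 => q i2 end).
  by move=> i; case: split.
rewrite big_split_ord; congr (_ + _); apply: eq_bigr => i _.
  by rewrite (unsplitK (inl _ i)).
by rewrite (unsplitK (inr _ i)).
Qed.

Lemma open_secant1 A p : A p -> open_secant 1 A p.
Proof. by move=> Ap; exists (fun=> p); rewrite ?big_ord1. Qed.

Lemma open_secant_mulrn k A p : A p -> open_secant k A (p *+ k).
Proof. by move=> Ap; exists (fun=> p); rewrite ?sumr_const ?card_ord. Qed.

(** The vectors whose translate by [p] lies in the next secant form a closed set that contains the
    open secant, hence its closure. *)
Lemma secant_add1 k A p v : A p -> secant k A v -> secant k.+1 A (p + v).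
Proof.
move=> Ap; have := @zclosed_affine _ _ _ 1 p (zclosed_closure (open_secant k.+1 A)).
move/zclosure_min => sub Sv; rewrite addrC -[v]scale1r; apply: sub Sv => u Su.
rewrite /= scale1r addrC; apply: sub_zclosure.
exact: open_secantD (open_secant1 Ap) Su.
Qed.

Lemma secant_sub k A h : (forall x, A x -> h x = 1) ->
  secant k A `<=` [set v | h v = k%:R].
Proof.
move=> hA; apply: zclosure_min; first exact: zclosed_hyperplane.
move=> _ [p Ap ->] /=; rewrite linear_sum (eq_bigr (fun=> 1)) => [|i _].
  by rewrite sumr_const card_ord.
exact: hA.
Qed.

Lemma dilate_hyperplane1 k h : [pchar K] =i pred0 -> (0 < k)%N ->
  dilate k (hyperplane1 h) = [set v | h v = k%:R].
Proof.
move=> charK k0; have kn0 : k%:R != 0 :> K by rewrite ((pcharf0P K).1 charK) -lt0n.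
rewrite eqEsubset; split=> [_ [p hp <-]|v /= hv] /=.
  by rewrite linearMn /= hp.
exists (k%:R^-1 *: v); last by rewrite -scaler_nat scalerA divff ?scale1r.
by rewrite /hyperplane1 /= linearZ /= hv /GRing.scale /= mulVf.
Qed.

(** * Hyperplane sections of an irreducible cone *)

Lemma polyfun_exp (f : V -> K) N : polyfun f -> polyfun (fun v => f v ^+ N).
Proof.
move=> pf; elim: N => [|N IHN].
  by have := @polyfunC _ V 1; congr polyfun; apply/funext => v; rewrite expr0.
have := polyfunM pf IHN; congr polyfun; apply/funext => v; by rewrite exprS.
Qed.

(** Clears the denominators of [f] at [x] divided by [h x]; the two terms of a sum are first brought
    to a common power of [h]. *)
Lemma homogenize h (f : V -> K) : polyfun f -> exists N g, polyfun g /\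
  forall x, h x != 0 -> g x = (h x : K) ^+ N * f ((h x : K)^-1 *: x).
Proof.
move=> [p ->]; pattern (peval p); apply: peval_ring_ind p => [c|i||].
- by exists 0%N, (fun=> c); split=> [|x _]; [exact: polyfunC|rewrite mul1r].
- exists 1%N, (coord (vbasis {:V}) i); split=> [|x hx]; first exact: polyfun_coord.
  by rewrite linearZ /= mulrA expr1 divff ?mul1r.
- move=> f1 f2 [N1 [g1 [pg1 g1E]]] [N2 [g2 [pg2 g2E]]].
  exists (N1 + N2)%N, (fun x => (h x : K) ^+ N2 * g1 x + (h x : K) ^+ N1 * g2 x).
  split=> [|x hx].
    by apply: polyfunD; apply: polyfunM => //; apply/polyfun_exp/polyfun_hom.
  by rewrite g1E // g2E // exprD; ring.
- move=> f1 f2 [N1 [g1 [pg1 g1E]]] [N2 [g2 [pg2 g2E]]].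
  exists (N1 + N2)%N, (fun x => g1 x * g2 x).
  split=> [|x hx]; first exact: polyfunM.
  by rewrite g1E // g2E // exprD; ring.
Qed.

Lemma cone_section_nonempty X h : affine_cone X -> spans X -> h != 0 ->
  (X `&` hyperplane1 h) !=set0.
Proof.
move=> coneX spanX h0; have [x [Xx hx]] : exists x, X x /\ h x != 0.
  apply: contrapT => /forallNP hX; case/eqP: h0; apply/lfunP => v.
  rewrite zero_lfunE; apply/eqP; rewrite -memv_ker.
  rewrite (spanX (lker h)) ?memvf // => x Xx; rewrite memv_ker.
  by apply: contraT => hx; case: (hX x).
exists ((h x : K)^-1 *: x); split; first exact: coneX.
by rewrite /hyperplane1 /= linearZ /= /GRing.scale /= mulVf.
Qed.

(** Functions on the section are homogenized to functions on [X], where irreducibility is known. *)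
Lemma zirreducible_cone_section X h : zirreducible X -> affine_cone X ->
  (X `&` hyperplane1 h) !=set0 -> zirreducible (X `&` hyperplane1 h).
Proof.
move=> /zirreducibleP[_ irrX] coneX X1n0; apply/zirreducibleP; split=> //.
move=> f g pf pg fg.
have [N [f' [pf' f'E]]] := homogenize h pf.
have [M [g' [pg' g'E]]] := homogenize h pg.
have one F F' L : (forall x, h x != 0 ->
    F' x = (h x : K) ^+ L * F ((h x : K)^-1 *: x)) ->
    forall x : V, h x = 1 -> F' x = F x :> K.
  by move=> FE x hx; rewrite FE hx ?oner_eq0 // expr1n mul1r invr1 scale1r.
(* The extra factor [h x] makes the product vanish where [h x = 0], where homogenization gives no
   information; it is 1 on the section. *)
have [||x Xx|h0|h0] := irrX (fun x => (h x : K) * f' x) g'.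
- by apply: polyfunM => //; apply: polyfun_hom.
- by [].
- have [->|hx] := eqVneq (h x) 0; first by rewrite !mul0r.
  rewrite f'E // g'E //; set y := _ *: x.
  have fgy : f y * g y = 0.
    apply: fg; split; first exact: coneX.
    by rewrite /hyperplane1 /y /= linearZ /= /GRing.scale /= mulVf.
  have -> (a b c d e : K) : a * (b * c) * (d * e) = a * b * d * (c * e) by ring.
  by rewrite fgy mulr0.
- left=> x [Xx hx]; have := h0 x Xx; rewrite hx mul1r.
  by rewrite (one _ _ _ f'E).
- by right=> x [Xx hx]; have := h0 x Xx; rewrite (one _ _ _ g'E).
Qed.

(** The vectors of [ker h] satisfying [P] form a subspace [W]. Rescaling puts every point of [X] off
    [ker h] in [W + <[p0]>]; irreducibility then puts all of [X] there, and [X] spans. *)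
Lemma cone_section_differences X h (P : V -> Prop) :
    zirreducible X -> spans X -> (X `&` hyperplane1 h) !=set0 ->
    P 0 -> (forall v w, P v -> P w -> P (v + w)) ->
    (forall a v, P v -> P (a *: v)) -> affine_cone X ->
    (forall p q, (X `&` hyperplane1 h) p -> (X `&` hyperplane1 h) q -> P (q - p)) ->
  forall v, h v = 0 -> P v.
Proof.
move=> [_ irrX] spanX [p0 [Xp0 hp0]] P0 PD PZ coneX Pdiff v hv.
have [||a u [Pu hu]|W WP] := @vspace_of_pred _ _ (fun v => P v /\ h v = 0).
- by split=> //; rewrite linear0.
- by move=> u w [Pu hu] [Pw hw]; split; [exact: PD|rewrite linearD /= hu hw addr0].
- by split; [exact: PZ|rewrite linearZ /= hu scaler0].
pose U := (W + <[p0]>)%VS.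
have cU := zclosed_vspace U; have cker := zclosed_hyperplane h 0.
have XU : X `<=` [set v | v \in U].
  case: (irrX _ _ cker cU) => // [x Xx|Xker].
    have [hx|hx] := eqVneq (h x) 0; first by left.
    have Wd : (h x : K)^-1 *: x - p0 \in W.
      apply/WP; split; last first.
        by rewrite linearB linearZ /= hp0 /GRing.scale /= mulVf ?subrr.
      apply: Pdiff => //; split; first exact: coneX.
      by rewrite /hyperplane1 /= linearZ /= /GRing.scale /= mulVf.
    right; rewrite /= -[x]scale1r -(divff hx) -scalerA memvZ //.
    rewrite -[_ *: x](subrK p0) memv_add // memv_line //.
  by have := Xker _ Xp0; rewrite /= hp0 => /eqP; rewrite oner_eq0.
have := memvf v; rewrite -(spanX U XU) => /memv_addP[w Ww [_ /vlineP[a ->] vE]].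
move/WP: Ww => [Pw hw].
have a0 : a = 0.
  by move: hv; rewrite vE linearD linearZ /= hw hp0 add0r /GRing.scale /= mulr1.
by rewrite vE a0 scale0r addr0.
Qed.

(** * Growth, stabilization and doubling of the secants *)

Lemma secant_grows X h k : [pchar K] =i pred0 ->
    zirreducible X -> affine_cone X -> spans X -> h != 0 ->
    let X1 := X `&` hyperplane1 h in
    secant k X1 <> [set v | h v = k%:R] ->
  exists p, X1 p /\ [set v | secant k X1 (v - p)] `<` secant k.+1 X1.
Proof.
move=> charK irrX coneX spanX h0 X1 Snk; apply: contrapT => /forallNP nlt.
have X1n0 := cone_section_nonempty coneX spanX h0.
have [p0 X1p0] := X1n0.
have back p v : X1 p -> secant k.+1 X1 v -> secant k X1 (v - p).
  move=> X1p Sv; apply: contrapT => nSv; apply: (nlt p); split=> //; split.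
    by move=> u Su; rewrite -[u](subrK p) addrC; apply: secant_add1.
  by move/(_ v Sv).
pose P w := forall s, secant k X1 s -> secant k X1 (s + w).
have Pker : forall v, h v = 0 -> P v.
  apply: (cone_section_differences irrX spanX X1n0) => //.
  - by move=> s; rewrite addr0.
  - by move=> v w Pv Pw s Ss; rewrite addrA; apply: Pw; apply: Pv.
  (* Iterating [Pw] gives the natural multiples of [w]. A polynomial vanishing on the secant,
     restricted to the line through [s] in direction [w], has all natural numbers as roots, hence
     vanishes at every scalar [a]. *)
  - move=> a w Pw s Ss; apply/(zclosureP (open_secant k X1)) => _ [p ->] pS.
    have [F FE] := peval_line p s w.
    suff F0 : F = 0 by rewrite FE F0 horner0.
    apply: pchar0_poly_eq0 => // m; rewrite -FE.
    have : secant k X1 (s + m%:R *: w).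
      rewrite scaler_nat; elim: m => [|m IHm]; first by rewrite mulr0n addr0.
      by rewrite mulrSr addrA; apply: Pw.
    by move/zclosureP; apply=> //; apply: polyfun_peval.
  - move=> p q X1p X1q s Ss; rewrite addrA [s + q]addrC.
    by apply: back => //; apply: secant_add1.
apply: Snk; rewrite eqEsubset; split=> [|v /= hv].
  by apply: secant_sub => x [].
(* [p0 *+ k] lies in the secant and differs from [v] by an element of [ker h]. *)
rewrite -[v](subrK (p0 *+ k)) addrC; apply: Pker.
  by rewrite linearB linearMn /= hv X1p0.2 subrr.
by apply: sub_zclosure; apply: open_secant_mulrn.
Qed.

Lemma secant_full_succ A h k : A !=set0 -> (forall x, A x -> h x = 1) ->
  secant k A = [set v | h v = k%:R] -> secant k.+1 A = [set v | h v = k.+1%:R].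
Proof.
move=> [p Ap] hA Sk; rewrite eqEsubset; split=> [|v /= hv]; first exact: secant_sub.
rewrite -[v](subrK p) addrC; apply: secant_add1 => //.
by rewrite Sk /= linearB /= hv hA // -natr1 addrK.
Qed.

Lemma open_secant_double A h k w : zclosed A -> zirreducible A -> h != 0 ->
    (forall x, A x -> h x = 1) -> secant k A = [set v | h v = k%:R] ->
    h w = (2 * k)%:R -> open_secant (2 * k) A w.
Proof.
move=> cA irrA h0 hA Sk hw.
have [f [pf [v1 ov1 fv1] fopen]] := open_secant_dense k cA irrA.
have hv1 : h v1 = k%:R by have := sub_zclosure ov1; rewrite -/(secant k A) Sk.
have hsub u : h u = k%:R -> h (w - u) = k%:R.
  by move=> hu; rewrite linearB /= hw hu mul2n -addnn natrD addrK.
have [u [hu fu]] : exists u, h u = k%:R /\ f u * f (w - u) != 0.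
  apply: contrapT => /forallNP nu.
  have [_ irrH] := (zirreducibleP _).1 (zirreducible_hyperplane k%:R h0).
  have pg : polyfun (fun u => f (w - u)).
    have := polyfun_affine (-1) w pf; congr polyfun; apply/funext => u.
    by rewrite scaleN1r addrC.
  have [u hu|fH|fH] := irrH _ _ pf pg.
  - by apply/eqP; apply: contraT => fu; case: (nu u).
  - by rewrite fH ?eqxx in fv1.
  (* At [u = w - v1] the second factor is [f v1], which is nonzero. *)
  - have := fH (w - v1) (hsub _ hv1); rewrite opprB addrC subrK => fv10.
    by rewrite fv10 eqxx in fv1.
move: fu; rewrite mulf_eq0 negb_or => /andP[fu fwu].
rewrite -[w](subrK u) addrC mul2n -addnn.
by apply: open_secantD; apply: fopen => //; rewrite Sk //=; apply: hsub.
Qed.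

End SecantsOfCone.

Theorem theorem1p4 (K : closedFieldType) (charK : [pchar K] =i pred0)
    (V : vectType K) (X : set V)
    (Xirr : zirreducible X) (Xclosed : zclosed X) (Xcone : affine_cone X)
    (Xspan : spans X) (h : 'Hom(V, K^o)) (h_neq0 : h != 0) :
  let H := hyperplane1 h in
  let X1 := X `&` H in
  has_zdim H (\dim {:V}).-1 /\
  (exists d : nat -> nat,
     (forall k, (0 < k)%N -> has_zdim (secant k X1) (d k)) /\
     exists k1 : nat,
       [/\ (0 < k1)%N,
           (forall i j, (0 < i)%N -> (i < j)%N -> (j <= k1)%N ->
              (d i < d j)%N)
         & (forall k, (k1 <= k)%N -> d k = (\dim {:V}).-1)]) /\
  (exists k0 : nat,
     is_least [set k | (0 < k)%N /\ secant k X1 = dilate k H] k0 /\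
     forall v : V, h v != 0 ->
       exists r m : nat,
         [/\ has_rank X v r, has_mrank X h v m, (r <= m)%N
           & (m <= 2 * k0)%N]).
Proof.
move=> H X1; have X1n0 := cone_section_nonempty Xcone Xspan h_neq0.
have hX1 x : X1 x -> h x = 1 by case.
have cX1 : zclosed X1 := zclosedI Xclosed (zclosed_hyperplane h 1).
have irrX1 : zirreducible X1 := zirreducible_cone_section Xirr Xcone X1n0.
have cS k : zclosed (secant k X1) := zclosed_closure _.
have irrS k : zirreducible (secant k X1) :=
  zirreducible_closure (zirreducible_open_secant k irrX1).
have [d dS] := choice (fun k => has_zdim_ex (cS k) (irrS k)).
(* A longest chain in the [k]-th secant, translated by [p], is extended by the next secant. *)
have d_lt k : secant k X1 <> [set v | h v = k%:R] -> (d k < d k.+1)%N.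
  move=> /(secant_grows charK Xirr Xcone Xspan h_neq0)[p [X1p lt]].
  have [[C chC] _] := dS k; have [_ maxd] := dS k.+1.
  have shiftE : [set v | secant k X1 (v - p)] = [set v | secant k X1 (1 *: v - p)].
    by apply/funext => v /=; rewrite scale1r.
  move: lt; rewrite shiftE => lt; apply: maxd.
  exact: zchain_extend (zchain_affine _ (oner_neq0 K) chC) lt (cS _) (irrS _).
have full_eq k : (0 < k)%N -> (secant k X1 = dilate k H) =
    (secant k X1 = [set v | h v = k%:R]).
  by move=> k0; rewrite dilate_hyperplane1.
have [k1 k1S] : exists k, (0 < k)%N /\ secant k X1 = dilate k H.
  apply: contrapT => /forallNP nfull.
  (* The index is shifted because [nfull] speaks of positive integers only; at [(\dim {:V}).+2] the
     dimension would exceed that of [V]. *)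
  have grow k : (k <= d k.+1)%N.
    elim: k => // k IHk; apply: leq_ltn_trans IHk (d_lt _ _) => e.
    by apply: (nfull k.+1); rewrite full_eq.
  have [[C chC] _] := dS (\dim {:V}).+2.
  by have := leq_trans (grow _) (zchain_leq_dim chC); rewrite ltnn.
have [k0 [[k0gt0 k0S] k0min]] := @ex_least
  [set k | (0 < k)%N /\ secant k X1 = dilate k H] k1 k1S.
have fullS k : (k0 <= k)%N -> secant k X1 = [set v | h v = k%:R].
  elim: k => [|k IHk]; first by rewrite leqn0 => /eqP e; rewrite e in k0gt0.
  rewrite leq_eqVlt => /orP[/eqP <-|]; first by rewrite -full_eq.
  by move/IHk; apply: secant_full_succ.
split; first exact: has_zdim_hyperplane.
split.
  (* The threshold [k1] of the statement is [k0] itself: below it, minimality rules out fullness, so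
     [d_lt] applies. *)
  exists d; split=> //; exists k0; split=> // [i j i0 ltij lejk0|k lek].
    elim: j ltij lejk0 => // j IHj; rewrite ltnS => leij ltjk0.
    have ltd : (d j < d j.+1)%N.
      apply: d_lt => e; have j0 : (0 < j)%N by apply: leq_trans leij.
      by have := k0min j; rewrite /= full_eq // => /(_ (conj j0 e)); rewrite leqNgt ltjk0.
    move: leij; rewrite leq_eqVlt => /orP[/eqP ->//|ltij].
    by apply: ltn_trans ltd; apply: IHj => //; apply: ltnW.
  apply: has_zdim_fun (dS k) _; rewrite fullS //; exact: has_zdim_hyperplane.
exists k0; split=> // v hv.
have mr2 : (0 < 2 * k0)%N /\
    open_secant (2 * k0) X1 (((2 * k0)%:R / (h v : K)) *: v).
  split; first by rewrite muln_gt0.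
  apply: open_secant_double (fullS k0 (leqnn _)) _ => //.
  by rewrite linearZ /= /GRing.scale /= divfK.
have [m [[m0 mS] mmin]] := @ex_least [set k | (0 < k)%N /\
    open_secant k X1 ((k%:R / (h v : K)) *: v)] _ mr2.
(* Rescaling each summand by [h v / m] keeps it in the cone, so the monic rank bounds the rank. *)
have rS : open_secant m X v.
  have [p X1p vE] := mS; exists (fun i => (h v / m%:R : K) *: p i).
    by move=> i; apply: Xcone; apply: (X1p i).1.
  have mn0 : m%:R != 0 :> K by rewrite ((pcharf0P K).1 charK) -lt0n.
  by rewrite -scaler_sumr -vE scalerA mulrA divfK // divff // scale1r.
have [r [rX rmin]] := @ex_least [set k | open_secant k X v] _ rS.
exists r, m; split=> //; [exact: rmin|exact: mmin].
Qed.
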